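(* Let $n\ge 1$ be an integer and let $a,b,c\in\mathbb{R}$ with $ac>0$. Put $s=\sqrt{ac}$, $A_n=A_n(a,b,c)$ and $S=A_n(s,b,s)$. Let $\lambda_k=b+2s\cos\left(\frac{k\pi}{n+1}\right)$, $1\le k\le n$, be the eigenvalues of $A_n$, and let $\lambda_{\max}$ and $\lambda_{\min}$ denote the largest and the smallest of them. Then $$\lambda_{\max}=b+2s\cos\left(\frac{\pi}{n+1}\right),\qquad \lambda_{\min}=b-2s\cos\left(\frac{\pi}{n+1}\right).$$ In particular, the symmetric Toeplitz matrix $S$ is positive definite if and only if $$b>2s\cos\left(\frac{\pi}{n+1}\right).$$
   Context: For $n\ge 1$ and $a,b,c\in\mathbb{R}$, $A_n(a,b,c)$ denotes the $n\times n$ tridiagonal Toeplitz matrix with all diagonal entries equal to $b$, all subdiagonal entries (positions $(i+1,i)$) equal to $a$, all superdiagonal entries (positions $(i,i+1)$) equal to $c$, and all other entries $0$. *)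

(* Defs.v *)
From mathcomp Require Import all_boot all_order all_algebra.
From mathcomp Require Import reals trigo.

Set Implicit Arguments.
Unset Strict Implicit.
Unset Printing Implicit Defensive.

Import Order.TTheory GRing.Theory Num.Theory.

Local Open Scope ring_scope.

Definition toeplitz3 (R : realType) (n : nat) (a b c : R) : 'M[R]_n :=
  \matrix_(i < n, j < n)
    if i == j :> nat then b
    else if i == j.+1 :> nat then a
    else if j == i.+1 :> nat then c
    else 0.

Definition toeplitz3_lambda (R : realType) (n : nat) (a b c : R) (k : nat) : R :=
  b + 2%:R * Num.sqrt (a * c) * cos (k%:R * pi / n.+1%:R).

Definition largest_eigenvalue (R : realType) (n : nat) (A : 'M[R]_n) (l : R) : Prop :=
  eigenvalue A l /\ forall x : R, eigenvalue A x -> x <= l.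

Definition smallest_eigenvalue (R : realType) (n : nat) (A : 'M[R]_n) (l : R) : Prop :=
  eigenvalue A l /\ forall x : R, eigenvalue A x -> l <= x.

Definition positive_definite (R : realType) (n : nat) (A : 'M[R]_n) : Prop :=
  A^T = A /\ forall x : 'cV[R]_n, x != 0 -> 0 < (x^T *m A *m x) 0 0.

(* Main.v *)
Require Import Defs.
From mathcomp Require Import all_boot all_order all_algebra.
From mathcomp Require Import reals trigo.
From mathcomp Require Import ring lra.

(** The spectrum comes from explicit eigenvectors.  Extend a row vector to a
    sequence [w] with [w 0 = w n.+1 = 0], its entries being [w 1], ..., [w n];
    then multiplying by the Toeplitz matrix is the three-term operator
    [c * w j + b * w j.+1 + a * w j.+2] with no boundary cases
    ([toeplitz3_row]).  Rescaling by powers of [r = s / a] turns [a] and [c]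
    into [s], after which the addition formula for [sin] says that
    [r ^+ j * sin (j t)] is an eigenvector with eigenvalue [b + 2 s cos t] as
    soon as [sin (n.+1 t) = 0], that is for [t = k pi / n.+1].  As [cos] is
    injective on [0, pi], this gives [n] distinct eigenvalues, which therefore
    exhaust the roots of the characteristic polynomial; as [cos] is decreasing
    there, the extreme ones are those with [k = 1] and [k = n].

    For the positivity criterion, one direction evaluates the quadratic form
    at an eigenvector for the smallest eigenvalue.  The converse
    needs no orthogonality of eigenvectors: the sequence [u j = sin (j pi / n.+1)] is
    positive on [1], ..., [n] and satisfies [u j + u j.+2 = t * u j.+1] with
    [t = 2 cos (pi / n.+1)], and the existence of such a positive solution
    forces the form [sum (w j + t * w j.+1 + w j.+2) * w j.+1] to be
    nonnegative ([ground_state_ge0]).  The form of the symmetric matrix is [s]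
    times that one plus [b - s t] times the sum of the squares. *)

Import Order.TTheory GRing.Theory Num.Theory.

Local Open Scope ring_scope.

(** * Sequences with Dirichlet boundary conditions *)

Lemma toeplitz3_row {R : realType} {n : nat} (a b c : R) (w : nat -> R) :
  w 0%N = 0 -> w n.+1 = 0 ->
  (\row_(j < n) w j.+1) *m toeplitz3 n a b c =
  \row_(j < n) (c * w j + b * w j.+1 + a * w j.+2).
Proof.
move=> w0 wn; apply/rowP => j; rewrite !mxE.
pose pick k (F : nat -> R) := \sum_(i < n) (if i == k :> nat then F i else 0).
have pickE k F : pick k F = if (k < n)%N then F k else 0.
  by rewrite /pick -big_mkcond big_ord1_eq.
transitivity (pick j (fun i => w i.+1 * b) + pick j.+1 (fun i => w i.+1 * a)
    + \sum_(i < n) (if j == i.+1 :> nat then w i.+1 * c else 0)).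
  rewrite /pick -!big_split /=; apply: eq_bigr => i _; rewrite !mxE.
  case: (ltngtP i j) => [ij|ij|->]; last first.
  - by rewrite !(ltn_eqF (ltnSn _)); ring.
  - by rewrite (ltn_eqF (leqW ij)); case: eqP => _; ring.
  - by rewrite (ltn_eqF (leqW ij)); case: eqP => _; ring.
have -> : \sum_(i < n) (if j == i.+1 :> nat then w i.+1 * c else 0) = w j * c.
  case: j => -[|j] jn /=; first by rewrite big1 ?w0 ?mul0r.
  transitivity (pick j (fun i => w i.+1 * c)); last by rewrite pickE (ltnW jn).
  by apply: eq_bigr => i _; rewrite eqSS eq_sym.
rewrite !pickE ltn_ord; case: ltnP => [_|nj]; first by ring.
have -> : j.+2 = n.+1 by congr _.+1; apply/eqP; rewrite eqn_leq ltn_ord.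
by rewrite wn; ring.
Qed.

(** Lets the quadratic form at an arbitrary vector be computed by
    [toeplitz3_row]. *)
Lemma dirichlet_extension {R : realType} {n : nat} (x : 'rV[R]_n) :
  exists w : nat -> R,
    [/\ w 0%N = 0, w n.+1 = 0 & x = \row_(j < n) w j.+1].
Proof.
exists (fun k => if k is i.+1 then
          if insub i is Some j then x 0 (j : 'I_n) else 0 else 0).
split=> //; first by rewrite insubF ?ltnn.
by apply/rowP => j; rewrite mxE valK.
Qed.

(** A positive solution [u] of the three-term equation makes the associated
    quadratic form nonnegative.  Completing squares from left to right
    (Gaussian elimination on the form), the pivot at step [m] is the ratio
    [u m.+1 / u m], and each step leaves
    [(u m.+1 * w m + u m * w m.+1) ^+ 2 / (u m * u m.+1)]. *)
Lemma ground_state_ge0 {R : realType} (n : nat) (t : R) (u w : nat -> R) :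
  (forall m, (1 <= m <= n)%N -> 0 < u m) -> 0 <= u 0%N -> 0 <= u n.+1 ->
  (forall m, u m + u m.+2 = t * u m.+1) ->
  w 0%N = 0 -> w n.+1 = 0 ->
  0 <= \sum_(j < n) (w j + t * w j.+1 + w j.+2) * w j.+1.
Proof.
move=> u_gt0 u0 un urec w0 wn.
have u_ge0 m : (m <= n)%N -> 0 <= u m.
  by case: m => // m mn; apply/ltW/u_gt0.
suff partial m : (m <= n)%N -> u m.+1 / u m * w m ^+ 2 + w m * w m.+1 <=
    \sum_(j < m) (w j + t * w j.+1 + w j.+2) * w j.+1.
  apply: le_trans (partial n (leqnn n)).
  by rewrite wn mulr0 addr0 mulr_ge0 ?sqr_ge0 ?divr_ge0 ?un ?u_ge0.
(* At [m = 0] the ratio may be a division by [u 0 = 0]; it multiplies [w 0]. *)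
elim: m => [_|m IHm mn]; first by rewrite w0 big_ord0 expr2 !(mulr0, mul0r) addr0.
rewrite big_ord_recr /=; have {IHm} := IHm (ltnW mn).
have um1 : 0 < u m.+1 by apply: u_gt0.
have -> : u m.+2 / u m.+1 = t - u m / u m.+1.
  by have := urec m => /(canRL (addKr _)) ->; field; rewrite gt_eqF.
(* The part of the next summand not passed on to the next pivot. *)
suff : 0 <= u m.+1 / u m * w m ^+ 2 + 2 * (w m * w m.+1)
            + u m / u m.+1 * w m.+1 ^+ 2.
  by move=> *; nra.
case: m mn um1 => [|m] mn um1.
  by rewrite w0 expr2 !(mulr0, mul0r) !add0r mulr_ge0 ?sqr_ge0 ?divr_ge0 // ltW.
have um : 0 < u m.+1 by apply: u_gt0; rewrite /= ltnW.
rewrite [leRHS](_ : _ = (u m.+2 * w m.+1 + u m.+1 * w m.+2) ^+ 2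
                          / (u m.+1 * u m.+2)).
  by rewrite divr_ge0 ?sqr_ge0 // mulr_ge0 // ltW.
by field; rewrite !gt_eqF.
Qed.

(** * The angles [k pi / n.+1] *)

Definition angle (R : realType) (n k : nat) : R := k%:R * pi / n.+1%:R.

Arguments angle {R} n k.

Lemma angle_itv {R : realType} n k : (k <= n.+1)%N -> angle n k \in `[0, (pi : R)].
Proof.
move=> kn; rewrite in_itv /= /angle; apply/andP; split.
  by rewrite !mulr_ge0 ?invr_ge0 ?ler0n ?pi_ge0.
by rewrite ler_pdivrMr ?ltr0Sn // mulrC ler_wpM2l ?pi_ge0 ?ler_nat.
Qed.

Lemma ltr_angle {R : realType} n k l : ((angle n k : R) < angle n l) = (k < l)%N.
Proof. by rewrite /angle ltr_pM2r ?invr_gt0 ?ltr0Sn // ltr_pM2r ?pi_gt0 // ltr_nat. Qed.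

Lemma ltr_cos_angle {R : realType} n k l : (k <= n.+1)%N -> (l <= n.+1)%N ->
  (cos (angle n l : R) < cos (angle n k)) = (k < l)%N.
Proof. by move=> kn ln; rewrite ltr_cos ?angle_itv // ltr_angle. Qed.

Lemma ler_cos_angle {R : realType} n k l : (k <= n.+1)%N -> (l <= n.+1)%N ->
  (cos (angle n l : R) <= cos (angle n k)) = (k <= l)%N.
Proof. by move=> kn ln; rewrite leNgt ltr_cos_angle // -leqNgt. Qed.

Lemma sin_angle_gt0 {R : realType} n k : (1 <= k <= n)%N ->
  0 < sin (angle n k : R).
Proof.
case/andP=> k0 kn; apply: sin_gt0_pi.
have a0 : angle n 0 = 0 :> R by rewrite /angle !mul0r.
have an : angle n n.+1 = pi :> R by rewrite /angle mulrAC divff ?mul1r ?pnatr_eq0.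
by rewrite -{1}a0 -an !ltr_angle k0 ltnS.
Qed.

Lemma cos_angle_last {R : realType} n : cos (angle n n : R) = - cos (angle n 1).
Proof.
have -> : angle n n = - angle n 1 + pi :> R.
  by rewrite /angle -natr1; field; rewrite natr1 pnatr_eq0.
by rewrite cosDpi cosN.
Qed.

Lemma sin_natM_pi {R : realType} k : sin (k%:R * pi : R) = 0.
Proof.
by elim: k => [|k IHk]; rewrite ?mul0r ?sin0 // -natr1 mulrDl mul1r sinDpi IHk oppr0.
Qed.

Lemma sin_three_term {R : realType} (t : R) (j : nat) :
  sin (j%:R * t) + sin (j.+2%:R * t) = 2 * cos t * sin (j.+1%:R * t).
Proof.
have -> : j%:R * t = j.+1%:R * t - t by rewrite -natr1; ring.
have -> : j.+2%:R * t = j.+1%:R * t + t by rewrite -[j.+2%:R]natr1; ring.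
by rewrite !sinD sinN cosN; ring.
Qed.

(** * Spectrum *)

Lemma toeplitz3_eigenvalue {R : realType} {n : nat} {a b c : R} (k : nat) :
  0 < a * c -> (1 <= k <= n)%N ->
  eigenvalue (toeplitz3 n a b c) (toeplitz3_lambda n a b c k).
Proof.
move=> ac kn; have a0 : a != 0 by apply: contraTneq ac => ->; rewrite mul0r ltxx.
set s := Num.sqrt (a * c); set t : R := angle n k.
have ss : s * s = a * c by rewrite -expr2 sqr_sqrtr ?ltW.
have s0 : s != 0 by rewrite gt_eqF // sqrtr_gt0.
(* The ratio balancing the two off-diagonals: both become [s]. *)
pose r := s / a.
have ar : a * r = s by rewrite /r mulrC divfK.
have cE : c = s * r by rewrite /r mulrA ss mulrAC divff ?mul1r.
pose w j := r ^+ j * sin (j%:R * t).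
have w0 : w 0%N = 0 by rewrite /w mul0r sin0 mulr0.
have wn : w n.+1 = 0.
  by rewrite /w /t /angle mulrC mulrC [_ * (_ / _)]mulrC divfK ?pnatr_eq0
             // sin_natM_pi mulr0.
apply/eigenvalueP; exists (\row_(j < n) w j.+1).
  rewrite toeplitz3_row //; apply/rowP => j; rewrite !mxE /w.
  rewrite /toeplitz3_lambda -/s -/(angle n k) -/t cE !exprS.
  have := sin_three_term t j => /(canRL (addrK _)) ->.
  by rewrite -ar; ring.
have n0 : (0 < n)%N by case/andP: kn => k0; apply: leq_trans.
apply/eqP => /rowP /(_ (Ordinal n0)); rewrite !mxE /w expr1 mul1r.
by apply/eqP; rewrite !mulf_neq0 ?invr_eq0 // gt_eqF ?sin_angle_gt0.
Qed.

(** A monic polynomial of degree [n] with [n] distinct known roots is the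
    product of the corresponding linear factors. *)
Lemma toeplitz3_char_poly {R : realType} {n : nat} (a b c : R) : 0 < a * c ->
  char_poly (toeplitz3 n a b c) =
  \prod_(1 <= k < n.+1) ('X - (toeplitz3_lambda n a b c k)%:P).
Proof.
move=> ac; set lam := toeplitz3_lambda n a b c.
have s2 : 2%:R * Num.sqrt (a * c) != 0.
  by rewrite mulf_neq0 ?pnatr_eq0 // gt_eqF // sqrtr_gt0.
rewrite [LHS](@all_roots_prod_XsubC _ _ (map lam (index_iota 1 n.+1))).
- by rewrite (monicP (char_poly_monic _)) scale1r big_map.
- by rewrite size_char_poly size_map size_iota subn1.
- apply/allP => _ /mapP[k kn ->]; rewrite -eigenvalue_root_char.
  by apply: toeplitz3_eigenvalue => //; move: kn; rewrite mem_index_iota.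
rewrite uniq_rootsE map_inj_in_uniq ?iota_uniq // => k l.
rewrite !mem_index_iota => /andP[_ kn] /andP[_ ln] /addrI /(mulfI s2) eq_cos.
have {}eq_cos : cos (angle n k) = cos (angle n l) :> R by exact: eq_cos.
have kl := @ler_cos_angle R _ _ _ (ltnW kn) (ltnW ln).
have lk := @ler_cos_angle R _ _ _ (ltnW ln) (ltnW kn).
by apply/eqP; rewrite eqn_leq -kl -lk eq_cos lexx.
Qed.

(** * Positive definiteness *)

(** A left eigenvector [v] gives [v A v^T = l * (v v^T)], and [v v^T] is
    nonnegative. *)
Lemma positive_definite_eigenvalue_gt0 {R : realType} {n : nat} {A : 'M[R]_n}
    {l : R} : positive_definite A -> eigenvalue A l -> 0 < l.
Proof.
move=> [_ Apos] /eigenvalueP[v vA v0].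
have := Apos v^T; rewrite trmx_eq0 trmxK vA -scalemxAl mxE => /(_ v0).
have : 0 <= (v *m v^T) 0 0.
  by rewrite mxE sumr_ge0 // => i _; rewrite mxE -expr2 sqr_ge0.
by move=> *; nra.
Qed.

Lemma sum_sqr_gt0 {R : realType} {n : nat} (w : nat -> R) :
  \row_(j < n) w j.+1 != 0 -> 0 < \sum_(j < n) w j.+1 ^+ 2.
Proof.
move=> /rV0Pn[i]; rewrite mxE => wi.
rewrite (bigD1 i) //= ltr_wpDr ?sumr_ge0 // => [j _|]; first exact: sqr_ge0.
by rewrite lt_def sqrf_eq0 wi sqr_ge0.
Qed.

(** The form is [s] times the one of [ground_state_ge0] plus a positive
    multiple of the sum of the squares; the ground state is the eigenvector
    of the largest eigenvalue. *)
Lemma toeplitz3_sym_positive_definite {R : realType} {n : nat} (b s : R) :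
  0 < s -> 2%:R * s * cos (angle n 1) < b -> positive_definite (toeplitz3 n s b s).
Proof.
move=> s0 bs; split.
  apply/matrixP => i j; rewrite !mxE eq_sym.
  by case: (i == j :> nat) => //; case: eqP; case: eqP.
move=> x x0; have [w [w0 wn xE]] := dirichlet_extension x^T.
have W : \row_(j < n) w j.+1 != 0 by rewrite -xE trmx_eq0.
have -> : x = (\row_(j < n) w j.+1)^T by rewrite -xE trmxK.
rewrite trmxK toeplitz3_row // mxE.
set t : R := 2 * cos (angle n 1).
have -> : \sum_(j < n) (\row_j (s * w j + b * w j.+1 + s * w j.+2)) 0 j
      * (\row_(j < n) w j.+1)^T j 0
    = s * (\sum_(j < n) (w j + t * w j.+1 + w j.+2) * w j.+1)
      + (b - s * t) * \sum_(j < n) w j.+1 ^+ 2.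
  by rewrite !mulr_sumr -big_split /=; apply: eq_bigr => j _; rewrite !mxE; ring.
rewrite ltr_wpDl //; last by rewrite mulr_gt0 ?sum_sqr_gt0 // /t; lra.
rewrite mulr_ge0 ?(ltW s0) //.
apply: (@ground_state_ge0 _ _ _ (fun m => sin (m%:R * angle n 1))) => //.
- move=> m mn; have -> : m%:R * angle n 1 = angle n m :> R.
    by rewrite /angle mul1r mulrA.
  exact: sin_angle_gt0.
- by rewrite mul0r sin0.
- by rewrite /angle mul1r [_ * (_ / _)]mulrC divfK ?pnatr_eq0 // sinpi.
- exact: sin_three_term.
Qed.

Theorem proposition5p2 (R : realType) (n : nat) (a b c : R) :
  (1 <= n)%N -> 0 < a * c ->
  let s := Num.sqrt (a * c) in
  let A := toeplitz3 n a b c in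
  let S := toeplitz3 n s b s in
  let lambda := toeplitz3_lambda n a b c in
  [/\ char_poly A = \prod_(1 <= k < n.+1) ('X - (lambda k)%:P),
      forall x : R, eigenvalue A x <-> exists2 k : nat, (1 <= k <= n)%N & x = lambda k,
      largest_eigenvalue A (b + 2%:R * s * cos (pi / n.+1%:R)),
      smallest_eigenvalue A (b - 2%:R * s * cos (pi / n.+1%:R))
    & positive_definite S <-> 2%:R * s * cos (pi / n.+1%:R) < b].
Proof.
move=> n0 ac s A S lambda.
have s0 : 0 < s by rewrite sqrtr_gt0.
have spectrum x :
    eigenvalue A x <-> exists2 k : nat, (1 <= k <= n)%N & x = lambda k.
  split=> [|[k kn ->]]; last exact: toeplitz3_eigenvalue.
  rewrite eigenvalue_root_char toeplitz3_char_poly //.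
  rewrite -(big_map lambda xpredT (fun z => 'X - z%:P)) root_prod_XsubC.
  by case/mapP=> k; rewrite mem_index_iota ltnS; exists k.
have lambda_le k l : (k <= l <= n)%N -> lambda l <= lambda k.
  case/andP=> kl ln; rewrite lerD2l ler_pM2l ?mulr_gt0 //.
  by rewrite ler_cos_angle // leqW // (leq_trans kl).
have angle1 : angle n 1 = pi / n.+1%:R :> R by rewrite /angle mul1r.
have lambda_first : lambda 1%N = b + 2%:R * s * cos (pi / n.+1%:R).
  by rewrite -angle1.
have lambda_last : lambda n = b - 2%:R * s * cos (pi / n.+1%:R).
  by rewrite -angle1 -mulrN -cos_angle_last.
split=> //; first exact: toeplitz3_char_poly.
- rewrite -lambda_first; split; first by apply/spectrum; exists 1%N.
  by move=> x /spectrum[k kn ->]; apply: lambda_le.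
- rewrite -lambda_last; split.
    by apply/spectrum; exists n; rewrite // n0 leqnn.
  by move=> x /spectrum[k /andP[_ kn] ->]; apply: lambda_le; rewrite kn leqnn.
rewrite -angle1; split; last exact: toeplitz3_sym_positive_definite.
move=> Spos; rewrite angle1 -subr_gt0 -lambda_last.
apply: (positive_definite_eigenvalue_gt0 Spos).
(* [S] and [A] share the parameter [s], hence the formula for the spectrum. *)
have -> : lambda n = toeplitz3_lambda n s b s n.
  by rewrite /lambda /toeplitz3_lambda -expr2 sqrtr_sqr gtr0_norm.
by apply: toeplitz3_eigenvalue; rewrite ?mulr_gt0 // n0 leqnn.
Qed.
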